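(* Let $a,b\in K$ satisfy $0<|a|<1$ and $|b|=q$, let $T:K^2\to K^2$ be the automorphism $T(x,y)=(ay+b(x^q-x),\,x)$, and let $\mathcal{A}_T=\bigcap_{n\ge 1}T^n(R^2)$. Then $T$ restricts to a map $T:\mathcal{A}_T\to\mathcal{A}_T$ which is topologically conjugate to the shift map $\sigma:\mathbb{F}^{\mathbb{Z}}\to\mathbb{F}^{\mathbb{Z}}$. More precisely, there exists a homeomorphism $\omega:\mathbb{F}^{\mathbb{Z}}\to\mathcal{A}_T$ such that $\omega\circ\sigma=T\circ\omega$.
   Context: $K$ is a field that is complete and locally compact with respect to a nontrivial non-Archimedean absolute value $|\cdot|$. $R=\{x\in K: |x|\le 1\}$ is its ring of integers, $\pi\in R$ is a uniformizing parameter (so $\pi R=\{x\in R:|x|<1\}$ is the unique maximal ideal of $R$), $\mathbb{F}=R/\pi R$ is the (finite) residue field, and $q=|\mathbb{F}|$ is its order. The absolute value is normalized so that $|\pi|=1/q$. The map $T$ is a bijection of $K^2$ with inverse $T^{-1}(x,y)=(y,\frac1a(x-b(y^q-y)))$. $\mathbb{F}^{\mathbb{Z}}$ is the set of bisequences $(s_k)_{k\in\mathbb{Z}}$ with each $s_k\in\mathbb{F}$, with the product topology ($\mathbb{F}$ discrete). The shift map $\sigma:\mathbb{F}^{\mathbb{Z}}\to\mathbb{F}^{\mathbb{Z}}$ is the homeomorphism for which the $k$-th term of $\sigma((s_k))$ is $s_{k+1}$. $K^2$ has the product topology and $\mathcal{A}_T$ the subspace topology. *)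

(* Defs.v *)
From HB Require Import structures.
From mathcomp Require Import all_boot all_order all_algebra ring_quotient finmap.
From mathcomp Require Import all_classical all_reals.
From mathcomp Require Import topology.

Set Implicit Arguments.
Unset Strict Implicit.
Unset Printing Implicit Defensive.

Import Order.TTheory GRing.Theory Num.Theory.
Local Open Scope classical_set_scope.
Local Open Scope ring_scope.

(** * Non-Archimedean valued fields *)

(* The structure does not extend [normedZmodType]: its axiom
   [`|x *+ n| = `|x| *+ n] is incompatible with the ultrametric inequality. *)
HB.mixin Record Metric_isNonArch (R : realType) K
    of GRing.Field K & Metric R K := {
  absv : K -> R;
  absv_ge0 : forall x, 0 <= absv x;
  absv_eq0 : forall x, absv x = 0 -> x = 0;
  absvM : forall x y, absv (x * y) = absv x * absv y;
  absvD_max : forall x y, absv (x + y) <= Num.max (absv x) (absv y);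
  mdist_absvE : forall x y : K, mdist x y = absv (x - y)
}.

#[short(type="nonArchFieldType")]
HB.structure Definition NonArchField (R : realType) :=
  { K of GRing.Field K & Metric R K & Metric_isNonArch R K }.

HB.factory Record Field_isNonArch (R : realType) K of GRing.Field K := {
  absv : K -> R;
  absv_ge0 : forall x, 0 <= absv x;
  absv_eq0 : forall x, absv x = 0 -> x = 0;
  absvM : forall x y, absv (x * y) = absv x * absv y;
  absv0 : absv 0 = 0;
  absvD_max : forall x y, absv (x + y) <= Num.max (absv x) (absv y)
}.

HB.builders Context R K of Field_isNonArch R K.

Let dist (x y : K) := absv (x - y).

Let distxx x : dist x x = 0. Proof. by rewrite /dist subrr absv0. Qed.

Let dist_positivity x y : dist x y = 0 -> x = y.
Proof. by move=> /absv_eq0/eqP; rewrite subr_eq0 => /eqP. Qed.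

Let absvN1 : absv (- 1) = 1.
Proof.
have a1 : absv 1 = 1.
  have n0 : absv 1 != 0 by apply/eqP => /absv_eq0/eqP; rewrite oner_eq0.
  by apply: (mulfI n0); rewrite -absvM !mulr1.
apply/eqP; rewrite -(@eqrXn2 _ 2)// ?absv_ge0//.
by rewrite expr1n expr2 -absvM mulrNN mulr1 a1.
Qed.

Let dist_sym x y : dist x y = dist y x.
Proof. by rewrite /dist -opprB -mulN1r absvM absvN1 mul1r. Qed.

Let dist_triangle y x z : dist x z <= dist x y + dist y z.
Proof.
rewrite /dist -(subrKA y) (le_trans (absvD_max _ _))// ge_max.
by rewrite lerDl lerDr !absv_ge0.
Qed.

HB.instance Definition _ := @isMetric.Build R K dist
  distxx dist_positivity dist_sym dist_triangle.

HB.instance Definition _ := @Metric_isNonArch.Build R K absv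
  absv_ge0 absv_eq0 absvM absvD_max (fun _ _ => erefl).

HB.end.

#[short(type="completeNonArchFieldType")]
HB.structure Definition CompleteNonArchField (R : realType) :=
  { K of NonArchField R K & Complete K }.

Section AbsvTheory.
Context {R : realType} {K : nonArchFieldType R}.

Lemma absv0 : absv (0 : K) = 0.
Proof. by rewrite -(subrr 0) -mdist_absvE mdistxx. Qed.

Lemma absv1 : absv (1 : K) = 1.
Proof.
have n0 : absv (1 : K) != 0.
  by apply/eqP => /absv_eq0/eqP; rewrite oner_eq0.
by apply: (mulfI n0); rewrite -absvM !mulr1.
Qed.

Lemma absvN (x : K) : absv (- x) = absv x.
Proof. by rewrite -sub0r -mdist_absvE metric_sym mdist_absvE subr0. Qed.

Lemma absvV (x : K) : absv x^-1 = (absv x)^-1.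
Proof.
have [->|x0] := eqVneq x 0; first by rewrite invr0 absv0 invr0.
have ax0 : absv x != 0 by apply: contra_neq x0 => /absv_eq0.
by apply: (mulfI ax0); rewrite -absvM !divff// absv1.
Qed.

Lemma absvB_max (x y : K) : absv (x - y) <= Num.max (absv x) (absv y).
Proof. by rewrite -(absvN y) absvD_max. Qed.

End AbsvTheory.

(** * Ring of integers, maximal ideal, residue field *)

Section Integers.
Context {R : realType} (K : nonArchFieldType R).

Definition integers : {pred K} := [pred x | absv x <= 1].

Lemma integers_subring_closed : subring_closed integers.
Proof.
split=> [|x y|x y]; rewrite !inE ?absv1// => x1 y1.
  by rewrite (le_trans (absvB_max _ _))// ge_max x1.
by rewrite absvM mulr_ile1// absv_ge0.
Qed.

HB.instance Definition _ :=
  GRing.isSubringClosed.Build K integers integers_subring_closed.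

Record integer_ring := IntegerRing {
  integer_val : K;
  integer_valP : integer_val \in integers
}.

HB.instance Definition _ := [isSub for integer_val].
HB.instance Definition _ := [Choice of integer_ring by <:].
HB.instance Definition _ := [SubChoice_isSubComNzRing of integer_ring by <:].

Definition max_ideal : {pred integer_ring} := [pred x | absv (\val x) < 1].

Lemma max_ideal_idealr_closed : idealr_closed max_ideal.
Proof.
split; rewrite ?inE ?rmorph0 ?rmorph1 ?absv0 ?absv1 ?ltr01 ?ltxx//.
move=> c u v; rewrite !inE => u1 v1.
rewrite rmorphD rmorphM/= (le_lt_trans (absvD_max _ _))// gt_max v1 andbT absvM.
rewrite (le_lt_trans _ u1)// ler_piMl ?absv_ge0//; exact: integer_valP.
Qed.

HB.instance Definition _ :=
  isIdealr.Build integer_ring max_ideal max_ideal_idealr_closed.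

Definition residue_field : Type := {ideal_quot max_ideal}.

HB.instance Definition _ := GRing.ComNzRing.on residue_field.

Local Notation red := (\pi_({ideal_quot max_ideal})%qT).

Definition residue_inv (x : residue_field) : residue_field :=
  red (insubd (0 : integer_ring) (\val (repr x))^-1).

Lemma residue_mulVf (x : residue_field) : x != 0 -> residue_inv x * x = 1.
Proof.
rewrite /residue_inv -[x in x != 0](@reprK _ {ideal_quot max_ideal}).
rewrite -[x in _ * x](@reprK _ {ideal_quot max_ideal}).
set r := repr x => r0.
have r1 : absv (\val r) = 1.
  apply/eqP; rewrite eq_le; apply/andP; split; first exact: (integer_valP r).
  rewrite leNgt; apply: contraNN r0 => r1.
  have -> : 0 = red (0 : integer_ring).
    by rewrite rmorph0.
  by rewrite -(Quotient.idealrBE max_ideal) subr0.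
have rn0 : \val r != 0.
  by apply/eqP => r0'; move/eqP: r1; rewrite r0' absv0 eq_sym oner_eq0.
rewrite -(rmorphM red) -(rmorph1 red); congr (red _); apply: val_inj.
rewrite rmorphM rmorph1/= insubdK ?inE ?absvV ?r1 ?invr1// mulVf//.
Qed.

Lemma residue_inv0 : residue_inv 0 = 0.
Proof.
rewrite /residue_inv; set r := repr _.
have r1 : absv (\val r) < 1.
  have : r - 0 \in max_ideal.
    by rewrite (Quotient.idealrBE max_ideal) reprK rmorph0.
  by rewrite subr0.
suff -> : insubd (0 : integer_ring) (\val r)^-1 = 0 by rewrite rmorph0.
have [r0|r0] := eqVneq (\val r) 0.
  by apply: val_inj; rewrite r0 invr0 insubdK// inE absv0.
have pr : 0 < absv (\val r).
  by rewrite lt_neqAle absv_ge0 andbT eq_sym; apply: contra_neq r0 => /absv_eq0.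
rewrite /insubd insubN// inE absvV -ltNge invf_gt1//.
Qed.

HB.instance Definition _ :=
  GRing.ComNzRing_isField.Build residue_field residue_mulVf residue_inv0.

(* The value is junk ([0]) for an infinite residue field; the residue field is
   finite when [K] is locally compact and the absolute value is nontrivial. *)
Definition residue_order : nat := #|` fset_set [set: residue_field]|.

Definition uniformizer (p : integer_ring) : Prop :=
  [set` max_ideal] = range (fun x => p * x).

Definition bisequence : Type := {ptws int -> discrete_topology residue_field}.

HB.instance Definition _ := Topological.on bisequence.

Definition shift (s : bisequence) : bisequence := fun k => s (k + 1).

Definition henon (a b : K) (z : K * K) : K * K :=
  (a * z.2 + b * (z.1 ^+ residue_order - z.1), z.1).

Definition attractor (a b : K) : set (K * K) :=
  \bigcap_(n in [set n | (1 <= n)%N])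
    (iter n (henon a b) @` ([set` integers] `*` [set` integers])).

End Integers.

Definition homeomorphism {X Y : topologicalType} (f : X -> Y) : Prop :=
  continuous f /\
  exists g : Y -> X, [/\ cancel f g, cancel g f & continuous g].

(* Main.v *)
Require Import Defs.
From mathcomp Require Import all_boot all_order all_algebra ring_quotient finmap.
From mathcomp Require Import all_classical all_reals topology.
From mathcomp Require normedtype sequences.
From mathcomp Require Import ring.

Set Implicit Arguments.
Unset Strict Implicit.
Unset Printing Implicit Defensive.

Import Order.TTheory GRing.Theory Num.Theory.
Local Open Scope classical_set_scope.
Local Open Scope ring_scope.

(* Points of the attractor correspond to bi-infinite orbits in the ring of
   integers, i.e. sequences with [x_(k+1) = a x_(k-1) + b (x_k^q - x_k)].  Such a
   sequence is a fixed point of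
     [(x_k)_k |-> (x_k^q - (x_(k+1) - a x_(k-1)) / b)_k],
   and this map preserves residues, because [u^q = u] in the residue field and
   [|1/b| = 1/q], and contracts distances between sequences with equal residues
   by [1/q], because [u^q - v^q = (u - v) * sum_i u^(q-1-i) v^i] and the sum
   reduces to [q u^(q-1) = 0].  Hence each bisequence of residues is realised by
   exactly one orbit; the contraction makes the orbit depend continuously on the
   residues, and the recurrence, read forwards and backwards, makes the residues
   depend continuously on the point. *)

(** * Arithmetic in a finite field *)

Section FiniteFieldAsSet.
Context {F : fieldType} (F_finite : finite_set [set: F]).
Local Notation elems := (enum_fset (fset_set [set: F])).

Let mem_elems x : x \in elems.
Proof. by rewrite in_fset_set// in_setT. Qed.

Let perm_elems (f : F -> F) : injective f -> (forall y, exists x, f x = y) ->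
  perm_eq elems (map f elems).
Proof.
move=> fI fS; apply: uniq_perm; rewrite ?map_inj_uniq ?fset_uniq//.
move=> y; rewrite mem_elems; have [x <-] := fS y.
by rewrite (mem_map fI) mem_elems.
Qed.

(** Translation by [1] permutes the field, so the sum of all elements is unchanged when one [1] per
    element is added to it. *)
Lemma finite_set_natr_card0 : #|` fset_set [set: F]|%:R = 0 :> F.
Proof.
have E : perm_eq elems (map (+%R 1) elems).
  apply: perm_elems; first exact: addrI.
  by move=> y; exists (y - 1); rewrite addrC subrK.
have /eqP := @perm_big F +%R 0 F _ _ xpredT id E.
rewrite big_map big_split/= -subr_eq0 opprD addrCA subrr addr0 oppr_eq0.
by rewrite big_const_seq count_predT iter_addr_0 => /eqP.
Qed.

(** For [x != 0], multiplication by [x] permutes the nonzero elements; comparing their products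
    gives exponent one less, and a last factor [x] covers [x = 0] as well. *)
Lemma finite_set_expf_card (x : F) : x ^+ #|` fset_set [set: F]| = x.
Proof.
have card_gt0 : (0 < size elems)%N.
  by have := mem_elems 0; case: elems.
have [->|x0] := eqVneq x 0; first by rewrite expr0n eqn0Ngt card_gt0.
have E : perm_eq elems (map ( *%R x) elems).
  apply: perm_elems; first exact: mulfI.
  by move=> y; exists (x^-1 * y); rewrite mulVKf.
have := @perm_big F *%R 1 F _ _ (fun y => y != 0) id E.
rewrite big_map; under [RHS]eq_bigl => y do rewrite mulf_eq0 (negPf x0) /=.
rewrite big_split/= -[LHS]mul1r => /mulIf/esym.
rewrite big_const_seq iter_mulr_1 (_ : count _ _ = (size elems).-1).
  have nz : \prod_(y <- elems | y != 0) y != 0 :> F.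
    by rewrite prodf_seq_neq0; apply/allP => y _; apply/implyP.
  by move=> /(_ nz) xE; rewrite -[#|` _|](prednK card_gt0) exprS xE mulr1.
(* The enumeration has no repetition, so [0] occurs in it exactly once. *)
rewrite -(count_predC (pred1 0) elems) count_uniq_mem ?fset_uniq// mem_elems.
by rewrite add1n.
Qed.

End FiniteFieldAsSet.

(** * Ultrametric estimates and the uniformizer *)

Section Ultrametric.
Context {R : realType} {K : nonArchFieldType R}.
Implicit Types (x y : K) (e : R).

Lemma absvD_le x y e : absv x <= e -> absv y <= e -> absv (x + y) <= e.
Proof. by move=> xe ye; rewrite (le_trans (absvD_max _ _))// ge_max xe. Qed.

Lemma absvB_le x y e : absv x <= e -> absv y <= e -> absv (x - y) <= e.
Proof. by move=> xe ye; rewrite (le_trans (absvB_max _ _))// ge_max xe. Qed.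

Lemma absv_gt0 x : (0 < absv x) = (x != 0).
Proof.
rewrite lt_neqAle absv_ge0 andbT eq_sym; congr (~~ _).
by apply/eqP/eqP => [/absv_eq0|->]; last exact: absv0.
Qed.

Lemma absvBC x y : absv (x - y) = absv (y - x).
Proof. by rewrite -absvN opprB. Qed.

Lemma exists_absv_lt1 : (exists x : K, x != 0 /\ absv x != 1) ->
  exists x : K, x != 0 /\ absv x < 1.
Proof.
move=> [x [x0 x1]]; case: (ltgtP (absv x) 1) x1 => // x1 _.
  by exists x.
by exists x^-1; rewrite invr_eq0 absvV invf_lt1// (lt_trans _ x1).
Qed.

(** Such an [x] is an integral multiple of [p]. This gap in the values just below [1] later turns
    strict bounds by [1] into a contraction factor. *)
Lemma uniformizer_absv_le (p : integer_ring K) x :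
  uniformizer p -> absv x < 1 -> absv x <= absv (\val p).
Proof.
move=> pU x1.
have xint : x \in @integers _ K by rewrite inE ltW.
have : [set` (@max_ideal _ K)] (IntegerRing xint) by rewrite /= inE.
rewrite pU => -[c _ /(congr1 val) xE]; rewrite -[x]xE rmorphM absvM.
by rewrite ler_piMr ?absv_ge0//; exact: integer_valP.
Qed.

(** Nontriviality supplies a nonzero element of the maximal ideal, whose value bounds that of [p]
    from below. *)
Lemma uniformizer_absv_gt0 (p : integer_ring K) :
    (exists x : K, x != 0 /\ absv x != 1) -> uniformizer p ->
  0 < absv (\val p).
Proof.
move=> /exists_absv_lt1[x [x0 x1]] pU; have := uniformizer_absv_le pU x1.
by apply: lt_le_trans; rewrite absv_gt0.
Qed.

Lemma uniformizer_absv_lt1 (p : integer_ring K) :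
  uniformizer p -> absv (\val p) < 1.
Proof.
move=> pU; suff : [set` (@max_ideal _ K)] p by rewrite /= inE.
by rewrite pU; exists 1; rewrite // mulr1.
Qed.

End Ultrametric.

(** * Reduction modulo the maximal ideal *)

Section Residue.
Context {R : realType} {K : nonArchFieldType R}.
Implicit Types x y : K.

(** [insubd] makes reduction total on [K]: a non-integral element gets the residue of [0]. *)
Definition residue x : residue_field K :=
  (\pi_({ideal_quot (@max_ideal _ K)}) (insubd (0 : integer_ring K) x))%qT.

Lemma residue_eq x y : x \in @integers _ K -> y \in @integers _ K ->
  (residue x == residue y) = (absv (x - y) < 1).
Proof.
move=> xint yint; rewrite /residue -(Quotient.idealrBE (@max_ideal _ K)).
by rewrite inE rmorphB/= !insubdK.
Qed.

Definition lift_residue (c : residue_field K) : K := \val (repr c).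

Lemma lift_residueP c : lift_residue c \in @integers _ K.
Proof. exact: integer_valP. Qed.

Lemma lift_residueK : cancel lift_residue residue.
Proof. by move=> c; rewrite /residue /lift_residue valKd reprK. Qed.

Context (residue_finite : finite_set [set: residue_field K]).
Local Notation q := (residue_order K).

Lemma absv_expf_order_sub x : x \in @integers _ K -> absv (x ^+ q - x) < 1.
Proof.
move=> xint; pose u := IntegerRing xint.
have : (\pi_({ideal_quot (@max_ideal _ K)}) (u ^+ q) ==
        \pi_({ideal_quot (@max_ideal _ K)}) u)%qT.
  by rewrite rmorphXn (finite_set_expf_card residue_finite).
by rewrite -(Quotient.idealrBE (@max_ideal _ K)) inE rmorphB rmorphXn.
Qed.

Lemma absv_sum_expf_order x y : x \in @integers _ K -> y \in @integers _ K ->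
  absv (x - y) < 1 -> absv (\sum_(i < q) x ^+ (q.-1 - i) * y ^+ i) < 1.
Proof.
move=> xint yint xy1.
pose u := IntegerRing xint; pose v := IntegerRing yint.
have uv : (\pi_({ideal_quot (@max_ideal _ K)}) u =
           \pi_({ideal_quot (@max_ideal _ K)}) v)%qT.
  by apply/eqP; rewrite -(Quotient.idealrBE (@max_ideal _ K)) inE rmorphB.
have : (\pi_({ideal_quot (@max_ideal _ K)})
          (\sum_(i < q) u ^+ (q.-1 - i) * v ^+ i) ==
        \pi_({ideal_quot (@max_ideal _ K)}) 0)%qT.
  rewrite rmorph_sum/=.
  rewrite (eq_bigr (fun=> (\pi_({ideal_quot (@max_ideal _ K)}) v ^+ q.-1)%qT)).
    rewrite sumr_const card_ord -mulr_natr.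
    by rewrite (finite_set_natr_card0 residue_finite) mulr0 rmorph0.
  move=> i _; rewrite rmorphM !rmorphXn/= uv -exprD subnK//.
  (* The index [i] itself witnesses [0 < q], so the truncated subtraction from [q.-1] is exact. *)
  by rewrite -ltnS prednK// (leq_ltn_trans _ (ltn_ord i)).
rewrite -(Quotient.idealrBE (@max_ideal _ K)) inE subr0 rmorph_sum.
by under eq_bigr do rewrite rmorphM !rmorphXn.
Qed.

End Residue.

(** * Geometric decay *)

Section GeometricDecay.
Import normedtype sequences numFieldNormedType.Exports.

Lemma exists_expr_lt {R : realType} (t e : R) : 0 <= t < 1 -> 0 < e ->
  exists n, t ^+ n.+1 < e.
Proof.
move=> /andP[t0 t1] e0.
have /(@cvg_expr R) tn : `|t| < 1 by rewrite ger0_norm.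
have [n _ /(_ n.+1 (leqnSn n))/=] := cvgr0_norm_lt _ tn e e0.
by rewrite ger0_norm ?exprn_ge0// => ?; exists n.
Qed.

End GeometricDecay.

(** Induction on the pair [P k], [P (k - 1)], as suits a second-order recurrence run in both
    directions from the indices [0] and [-1]. *)
Lemma int_ind2 (P : int -> Prop) : P 0 -> P (- 1) ->
  (forall k, P (k - 1) -> P k -> P (k + 1)) ->
  (forall k, P k -> P (k + 1) -> P (k - 1)) -> forall k, P k.
Proof.
move=> P0 PN1 PS PP k; suff [] : P k /\ P (k - 1) by [].
elim/int_rect: k => [|n [Pn Pn1]|n [Pn Pn1]]; first by rewrite sub0r.
- have -> : n.+1%:Z = n%:Z + 1 by rewrite -addn1 PoszD.
  by rewrite addrK; split=> //; exact: PS.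
- have -> : - n.+1%:Z = - n%:Z - 1 by rewrite -addn1 PoszD opprD.
  by split=> //; apply: PP; rewrite ?subrK.
Qed.

(** * Limits of sequences with geometrically small increments *)

Section UltrametricCauchy.
Context {R : realType} {K : completeNonArchFieldType R}.
Context {t : R} (t01 : 0 < t < 1).

(** A telescoping sum is bounded by its largest increment, so no constant from a geometric series
    appears. *)
Lemma absv_sub_telescope (v : nat -> K) (n m : nat) :
  (forall n, absv (v n.+1 - v n) <= t ^+ n.+1) -> (n <= m)%N ->
  absv (v m - v n) <= t ^+ n.+1.
Proof.
have [t0 t1] := andP t01; move=> vS /subnK <-; elim: (m - n)%N => [|i IH].
  by rewrite subrr absv0 exprn_ge0// ltW.
rewrite -(subrKA (v (i + n)%N)) absvD_le//.
by rewrite (le_trans (vS _))// ler_wiXn2l ?ltW// !ltnS leq_addl.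
Qed.

Lemma exists_ultrametric_limit (v : nat -> K) :
    (forall n, absv (v n.+1 - v n) <= t ^+ n.+1) ->
  exists l, forall n, absv (l - v n) <= t ^+ n.+1.
Proof.
have [t0 t1] := andP t01; move=> vS.
have : cvg (v @ \oo).
  apply: cauchy_cvg; apply: cauchy_exP => e e0.
  have [|n tne] := @exists_expr_lt _ t e _ e0; first by rewrite ltW.
  exists (v n), n => // m /= nm.
  rewrite /= ballEmdist/= mdist_absvE absvBC (le_lt_trans _ tne)//.
  exact: absv_sub_telescope.
move=> /cvg_ballP vl; exists (lim (v @ \oo)) => n.
(* The index [maxn m n] is both close to the limit and beyond [n], so the bound passes to the limit
   unchanged. *)
have /vl[m _ /(_ (maxn m n) (leq_maxl _ _))] : 0 < t ^+ n.+1.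
  by rewrite exprn_gt0.
rewrite /= ballEmdist/= mdist_absvE => /ltW lvm.
by rewrite -(subrKA (v (maxn m n))) absvD_le// absv_sub_telescope// leq_maxr.
Qed.

End UltrametricCauchy.

(** * Integral orbits, with [t] standing for the absolute value of a uniformizer *)

Section Orbits.
Context {R : realType} {K : completeNonArchFieldType R}.
Context (residue_finite : finite_set [set: residue_field K]).
Context {t : R} (t01 : 0 < t < 1).
Context (lt1_le_t : forall x : K, absv x < 1 -> absv x <= t).
Context (a b : K) (a_neq0 : a != 0) (a_le1 : absv a <= 1).
Context (absv_b : absv b = t^-1).
Local Notation q := (residue_order K).
Local Notation O := (@integers _ K).
Implicit Types (u v w : K) (x y : int -> K).

Let t_gt0 : 0 < t. Proof. by case/andP: t01. Qed.
Let t_lt1 : t < 1. Proof. by case/andP: t01. Qed.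

Let b_neq0 : b != 0.
Proof.
apply: contraTneq t_gt0 => b0; move: absv_b; rewrite b0 absv0 => /eqP.
by rewrite eq_sym invr_eq0 => /eqP ->; rewrite ltxx.
Qed.

Let absv_divb u : absv (u / b) = t * absv u.
Proof. by rewrite absvM absvV absv_b invrK mulrC. Qed.

(** One coordinate of the fixed-point map; [v], [u], [w] stand for the entries at [k - 1], [k],
    [k + 1]. *)
Definition branch v u w : K := u ^+ q - (w - a * v) / b.

Lemma branchP v u w : u = branch v u w <-> w = a * v + b * (u ^+ q - u).
Proof.
split=> [E|->]; last first.
  by rewrite /branch; move: (u ^+ q) => p; field.
have -> : u ^+ q - u = (w - a * v) / b by rewrite [X in _ - X]E /branch subKr.
by rewrite [b * _]mulrC divfK// addrC subrK.
Qed.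

Lemma absv_expf_order_sub_contract u v : u \in O -> v \in O ->
  absv (u - v) < 1 -> absv (u ^+ q - v ^+ q) <= t * absv (u - v).
Proof.
move=> uO vO uv1; rewrite subrXX absvM mulrC ler_wpM2r ?absv_ge0//.
by apply: lt1_le_t; apply: absv_sum_expf_order.
Qed.

Lemma absv_expf_order_sub_le u v : u \in O -> v \in O ->
  absv (u ^+ q - v ^+ q) <= absv (u - v).
Proof.
move=> uO vO; rewrite subrXX absvM ler_piMr ?absv_ge0//.
rewrite -[_ <= 1]/(_ \in O); apply: rpred_sum => i _.
by rewrite rpredM// rpredX.
Qed.

(** Both [u ^+ q - u] and the quotient by [b] have absolute value at most [t], the latter because
    dividing by [b] costs a factor [t]. *)
Lemma branch_integer v u w : v \in O -> u \in O -> w \in O ->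
  branch v u w \in O /\ absv (branch v u w - u) <= t.
Proof.
move=> vO uO wO.
have d1 : absv (branch v u w - u) <= t.
  rewrite /branch addrAC absvB_le//; first exact/lt1_le_t/absv_expf_order_sub.
  rewrite absv_divb ger_pMr// -[_ <= 1]/(_ \in O) rpredB// rpredM//.
split=> //; rewrite -(subrK u (branch v u w)) rpredD//.
by rewrite inE (le_trans d1)// ltW.
Qed.

(** The factor [t] comes from equal residues for the [q]-th powers and from the division by [b] for
    the neighbours. *)
Lemma branch_contract v u w v' u' w' e : u \in O -> u' \in O ->
  absv (u - u') < 1 -> absv (v - v') <= e -> absv (u - u') <= e ->
  absv (w - w') <= e -> absv (branch v u w - branch v' u' w') <= t * e.
Proof.
move=> uO u'O u1 ve ue we.
have -> : branch v u w - branch v' u' w' =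
    (u ^+ q - u' ^+ q) - ((w - w') - a * (v - v')) / b.
  by rewrite /branch; move: (u ^+ q) (u' ^+ q) => p p'; field.
rewrite absvB_le//.
  by rewrite (le_trans (absv_expf_order_sub_contract _ _ _))// ler_pM2l.
rewrite absv_divb ler_pM2l// absvB_le// absvM (le_trans _ ve)//.
by rewrite ler_piMl ?absv_ge0.
Qed.

Definition henon_orbit x : Prop := forall k,
  x k \in O /\ x (k + 1) = a * x (k - 1) + b * (x k ^+ q - x k).

Lemma orbit_branch x k : henon_orbit x ->
  x k = branch (x (k - 1)) (x k) (x (k + 1)).
Proof. by move=> /(_ k)[_ /branchP]. Qed.

(** Inductive step for uniqueness of orbits and for continuity of the coding: a bound on three
    consecutive entries improves at the middle one. *)
Lemma orbit_contract x y k e : henon_orbit x -> henon_orbit y ->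
  residue (x k) = residue (y k) -> absv (x (k - 1) - y (k - 1)) <= e ->
  absv (x k - y k) <= e -> absv (x (k + 1) - y (k + 1)) <= e ->
  absv (x k - y k) <= t * e.
Proof.
move=> xorb yorb xyk.
have [xO _] := xorb k; have [yO _] := yorb k.
move=> e1 e2 e3; rewrite (orbit_branch k xorb) (orbit_branch k yorb).
by apply: branch_contract => //; rewrite -residue_eq// xyk.
Qed.

(** One step forward multiplies by [b], hence loses at most a factor [t^-1]; the backward step below
    also divides by [a]. *)
Lemma orbit_succ_le x y k e : henon_orbit x -> henon_orbit y -> 0 <= e ->
  absv (x (k - 1) - y (k - 1)) <= e -> absv (x k - y k) <= e ->
  absv (x (k + 1) - y (k + 1)) <= e / t.
Proof.
move=> xorb yorb e0 e1 e2; have [xO ->] := xorb k; have [yO ->] := yorb k.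
have -> : a * x (k - 1) + b * (x k ^+ q - x k) -
    (a * y (k - 1) + b * (y k ^+ q - y k)) =
    a * (x (k - 1) - y (k - 1)) +
    b * ((x k ^+ q - y k ^+ q) - (x k - y k)).
  by move: (x k ^+ q) (y k ^+ q) => p p'; ring.
apply: absvD_le.
  rewrite absvM (@le_trans _ _ e)//; last first.
    by rewrite ler_pdivlMr// ler_piMr// ltW.
  by rewrite (le_trans _ e1)// ler_piMl ?absv_ge0.
rewrite absvM absv_b mulrC ler_pM2r ?invr_gt0//.
by rewrite absvB_le// (le_trans (absv_expf_order_sub_le _ _)).
Qed.

Lemma orbit_pred_le x y k e : henon_orbit x -> henon_orbit y -> 0 <= e ->
  absv (x k - y k) <= e -> absv (x (k + 1) - y (k + 1)) <= e ->
  absv (x (k - 1) - y (k - 1)) <= e / (t * absv a).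
Proof.
move=> xorb yorb e0 e1 e2; have [xO xk] := xorb k; have [yO yk] := yorb k.
have a_gt0 : 0 < absv a by rewrite absv_gt0.
have -> : x (k - 1) - y (k - 1) = ((x (k + 1) - y (k + 1)) -
    b * ((x k ^+ q - y k ^+ q) - (x k - y k))) / a.
  by rewrite xk yk; move: (x k ^+ q) (y k ^+ q) => p p'; field.
rewrite absvM absvV invfM mulrA ler_pM2r ?invr_gt0//; apply: absvB_le.
  by rewrite (le_trans e2)// ler_pdivlMr// ler_piMr// ltW.
rewrite absvM absv_b mulrC ler_pM2r ?invr_gt0//.
by rewrite absvB_le// (le_trans (absv_expf_order_sub_le _ _)).
Qed.

Lemma orbit_eq_init x y : henon_orbit x -> henon_orbit y ->
  x 0 = y 0 -> x (- 1) = y (- 1) -> x =1 y.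
Proof.
move=> xorb yorb xy0 xy1; apply: int_ind2 => // k.
- move=> E1 E2; have [_ ->] := xorb k; have [_ ->] := yorb k.
  by rewrite E1 E2.
- move=> E1 E2; have [_ xk] := xorb k; have [_ yk] := yorb k.
  apply: (mulfI a_neq0); apply: (addIr (b * (x k ^+ q - x k))).
  by rewrite -xk E1 -yk.
Qed.

Lemma eq0_of_absv_le_expr u : (forall n, absv u <= t ^+ n.+1) -> u = 0.
Proof.
move=> ule; apply: absv_eq0; apply/eqP; rewrite eq_le absv_ge0 andbT leNgt.
apply/negP => u0; have [|n] := @exists_expr_lt _ t _ _ u0.
  by rewrite ltW.
by rewrite ltNge ule.
Qed.

(** Equal residues bound the difference by [t] at all indices at once, and each contraction step
    gains another factor [t]. *)
Lemma orbit_eq_residue x y : henon_orbit x -> henon_orbit y ->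
  (forall k, residue (x k) = residue (y k)) -> x =1 y.
Proof.
move=> xorb yorb xy k; apply/eqP; rewrite -subr_eq0; apply/eqP.
apply: eq0_of_absv_le_expr => n; elim: n k => [|n IH] k.
  have [xO _] := xorb k; have [yO _] := yorb k.
  by apply: lt1_le_t; rewrite -residue_eq// xy.
by rewrite exprS; apply: orbit_contract.
Qed.

Lemma exists_orbit (s : int -> residue_field K) :
  exists x, henon_orbit x /\ forall k, residue (x k) = s k.
Proof.
(* [v n] is the [n]-th iterate of the fixed-point map, started at arbitrary lifts of the
   residues. *)
have [v [v0 vE]] : exists v : nat -> int -> K,
    (forall k, v 0%N k = lift_residue (s k)) /\
    (forall n k, v n.+1 k = branch (v n (k - 1)) (v n k) (v n (k + 1))).
  exists (fix v n k := if n is n'.+1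
    then branch (v n' (k - 1)) (v n' k) (v n' (k + 1)) else lift_residue (s k)).
  by [].
have vO n k : v n k \in O.
  elim: n k => [|n IH] k; first by rewrite v0 lift_residueP.
  by rewrite vE; have [] := branch_integer (IH (k - 1)) (IH k) (IH (k + 1)).
have vS n k : absv (v n.+1 k - v n k) <= t ^+ n.+1.
  elim: n k => [|n IH] k.
    rewrite vE.
    by have [] := branch_integer (vO 0%N (k - 1)) (vO 0%N k) (vO 0%N (k + 1)).
  rewrite exprS vE [in X in _ - X]vE; apply: branch_contract => //.
  by rewrite (le_lt_trans (IH k))// exprn_ilt1// ltW.
have /choice[l lv] k : exists l, forall n, absv (l - v n k) <= t ^+ n.+1.
  exact: (exists_ultrametric_limit t01 (vS^~ k)).
have lv1 n k : absv (l k - v n k) < 1.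
  by rewrite (le_lt_trans (lv k n))// exprn_ilt1// ltW.
have lO k : l k \in O.
  by rewrite -(subrK (v 0%N k) (l k)) rpredD// inE ltW.
exists l; split=> [k|k]; last first.
  by rewrite -[RHS]lift_residueK -v0; apply/eqP; rewrite residue_eq// lv1.
split=> //; apply/branchP; apply/eqP; rewrite -subr_eq0; apply/eqP.
apply: eq0_of_absv_le_expr => n.
(* The iterate [v n.+1 k] is close to [l k], and, being a [branch] of entries of [v n], also to the
   [branch] of the limits. *)
rewrite -(subrKA (v n.+1 k)); apply: absvD_le.
  by rewrite (le_trans (lv k _))// ler_wiXn2l// ltW.
rewrite absvBC (@le_trans _ _ (t * t ^+ n.+1))//.
  by rewrite vE branch_contract.
by rewrite ler_piMl// ?exprn_ge0// ltW.
Qed.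

End Orbits.

(** * Points of the attractor as initial data of orbits *)

Section Attractor.
Context {R : realType} {K : completeNonArchFieldType R}.
Context (a b : K) (a_neq0 : a != 0).
Local Notation q := (residue_order K).
Local Notation O := (@integers _ K).

Definition henon_inv (z : K * K) : K * K :=
  (z.2, (z.1 - b * (z.2 ^+ q - z.2)) / a).

Lemma henonK : cancel (henon a b) henon_inv.
Proof.
by case=> u v; rewrite /henon /henon_inv/= addrK [a * v]mulrC mulfK.
Qed.

Lemma henon_invK : cancel henon_inv (henon a b).
Proof.
by case=> u v; rewrite /henon /henon_inv/= [a * _]mulrC divfK// subrK.
Qed.

Lemma iter_henonK n : cancel (iter n (henon a b)) (iter n henon_inv).
Proof. by elim: n => // n IH z; rewrite iterSr iterS henonK IH. Qed.

Lemma iter_henon_orbit (x : int -> K) k n : henon_orbit a b x ->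
  iter n (henon a b) (x k, x (k - 1)) = (x (k + n%:Z), x (k + n%:Z - 1)).
Proof.
move=> xorb; elim: n => [|n IH]; first by rewrite addr0.
rewrite iterS IH /henon/=; have [_ <-] := xorb (k + n%:Z).
by rewrite -addn1 PoszD addrA addrK.
Qed.

(** The point [n] steps earlier on the orbit is the preimage required by the [n]-th image. *)
Lemma orbit_attractor (x : int -> K) :
  henon_orbit a b x -> attractor a b (x 0, x (- 1)).
Proof.
move=> xorb n _; exists (x (- n%:Z), x (- n%:Z - 1)).
  by split; case: (xorb (- n%:Z)) => //; case: (xorb (- n%:Z - 1)).
by rewrite iter_henon_orbit// addNr sub0r.
Qed.

(** Backward iterates are integral because [z] lies in every image and the map is injective; forward
    ones because the map preserves the integral square. *)
Lemma attractor_orbit (z : K * K) :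
    (forall u, u \in O -> b * (u ^+ q - u) \in O) -> a \in O ->
    attractor a b z ->
  exists2 x, henon_orbit a b x & z = (x 0, x (- 1)).
Proof.
move=> bO aO zA.
pose inO2 (w : K * K) := w.1 \in O /\ w.2 \in O.
have henonO w : inO2 w -> inO2 (henon a b w).
  by move=> [w1 w2]; split => //=; rewrite rpredD ?bO// rpredM.
have backO n : inO2 (iter n.+1 henon_inv z).
  by have [w wO <-] := zA n.+1 (ltn0Sn n); rewrite iter_henonK.
(* The intersection starts at [n = 1], so [z] itself is reached as the image of its first backward
   iterate. *)
have zO : inO2 z by rewrite -(henon_invK z); exact: henonO (backO 0%N).
have fwdO n : inO2 (iter n (henon a b) z) by elim: n => // n /henonO.
(* [Negz n] is the index [-(n+1)], so the second coordinate of the [n]-th backward iterate belongs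
   there; in particular [x (- 1)] is [z.2]. *)
pose x (k : int) := match k with
  | Posz n => (iter n (henon a b) z).1
  | Negz n => (iter n henon_inv z).2
  end.
exists x; last by case: z {zA zO backO fwdO} @x.
have xO k : x k \in O.
  case: k => [n|[|n]] /=; [by case: (fwdO n)|by case: zO|by case: (backO n)].
move=> k; split=> //; case: k => [[|n]|n].
- by [].
- have -> : n.+1%:Z + 1 = n.+2%:Z by rewrite -PoszD addn1.
  have -> : n.+1%:Z - 1 = n%:Z by rewrite -addn1 PoszD addrK.
  by [].
- have -> : Negz n - 1 = Negz n.+1 by rewrite !NegzE -opprD -PoszD addn1.
  (* [henon_inv] moves the second coordinate into the first; for [n = 0] both sides are [z.1]. *)
  have -> : x (Negz n + 1) = (iter n henon_inv z).1.
    case: n => [//|n].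
    suff -> : Negz n.+1 + 1 = Negz n by [].
    by rewrite !NegzE -addn1 PoszD opprD addrNK.
  rewrite [x (Negz n.+1)]/= [x (Negz n)]/=.
  by rewrite /= [a * _]mulrC divfK// subrK.
Qed.

End Attractor.

(** * Continuity of the coding in both directions *)

Section Coding.
Context {R : realType} {K : completeNonArchFieldType R}.
Context (residue_finite : finite_set [set: residue_field K]).
Context {t : R} (t01 : 0 < t < 1).
Context (lt1_le_t : forall x : K, absv x < 1 -> absv x <= t).
Context (a b : K) (a_neq0 : a != 0) (a_le1 : absv a <= 1).
Context (absv_b : absv b = t^-1).

Let t_gt0 : 0 < t. Proof. by case/andP: t01. Qed.

Lemma near_bisequence_eq (s : bisequence K) k : \forall s' \near s, s' k = s k.
Proof.
have : nbhs (s k : discrete_topology (residue_field K)) [set s k].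
  by rewrite nbhs_principalE; apply/principal_filterP.
exact: (@proj_continuous int (fun=> discrete_topology (residue_field K)) k s).
Qed.

(** After [n] contractions the bound at [k] depends only on the symbols from [k - n] to [k + n],
    each of which is locally constant. *)
Lemma orbit_coding_continuous (x : bisequence K -> int -> K) k :
    (forall s, henon_orbit a b (x s)) ->
    (forall s k, residue (x s k) = s k) -> continuous (x^~ k).
Proof.
move=> xorb xs s.
have xN n : \forall s' \near s, absv (x s k - x s' k) <= t ^+ n.+1.
  elim: n k => [|n IH] k.
    near=> s'; apply: lt1_le_t.
    have [xO _] := xorb s k; have [yO _] := xorb s' k.
    rewrite -residue_eq// !xs eq_sym; apply/eqP; near: s'.
    exact: near_bisequence_eq.
  near=> s'; rewrite exprS.
  apply: (orbit_contract residue_finite t01 lt1_le_t a_le1 absv_b) => //.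
  - by rewrite !xs; apply/esym; near: s'; exact: near_bisequence_eq.
  - by near: s'; exact: IH.
  - by near: s'; exact: IH.
  - by near: s'; exact: IH.
apply/(@cvg_ballP _ _ _ _ (nbhs_filter s)) => e e0.
have [|n tne] := @exists_expr_lt _ t e _ e0.
  by case/andP: t01 => /ltW ->.
near=> s'; rewrite ballEmdist/= mdist_absvE (le_lt_trans _ tne)//.
by near: s'; exact: xN.
Unshelve. all: by end_near. Qed.

(** The recurrence is Lipschitz in both directions, so continuity spreads from two adjacent entries
    to all others. *)
Lemma orbit_continuous (T : topologicalType) (x : T -> int -> K) :
    (forall z, henon_orbit a b (x z)) ->
    continuous (x^~ 0) -> continuous (x^~ (- 1)) ->
  forall k, continuous (x^~ k).
Proof.
move=> xorb x0 x1 + z.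
suff xN k : forall e, 0 < e -> \forall z' \near z, absv (x z k - x z' k) <= e.
  move=> k; apply/cvg_ballP => e e0.
  near=> z'; rewrite ballEmdist/= mdist_absvE (@le_lt_trans _ _ (e / 2))//.
    by near: z'; apply: xN; rewrite divr_gt0.
  by rewrite ltr_pdivrMr// ltr_pMr// ltr1n.
have a_gt0 : 0 < absv a by rewrite absv_gt0.
have near_le j : continuous (x^~ j) ->
    forall e, 0 < e -> \forall z' \near z, absv (x z j - x z' j) <= e.
  move=> /(_ z)/cvg_ballP xj e e0; near=> z'.
  by rewrite ltW// -mdist_absvE; near: z'; have := xj e e0; rewrite ballEmdist.
move: k; apply: int_ind2.
- exact: near_le.
- exact: near_le.
(* The two known entries are kept within [e * t], since the forward step may enlarge the error by
   [t^-1]. *)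
- move=> k IH1 IH2 e e0; have et0 : 0 < e * t by rewrite mulr_gt0.
  near=> z'; rewrite -[e](mulfK (lt0r_neq0 t_gt0)).
  apply: (orbit_succ_le t01 a_le1 absv_b) => //; first exact: ltW.
    by near: z'; exact: IH1.
  by near: z'; exact: IH2.
- move=> k IH1 IH2 e e0; have ta0 : 0 < t * absv a by rewrite mulr_gt0.
  have et0 : 0 < e * (t * absv a) by rewrite mulr_gt0.
  near=> z'; rewrite -[e](mulfK (lt0r_neq0 ta0)).
  apply: (orbit_pred_le t01 a_neq0 absv_b) => //; first exact: ltW.
    by near: z'; exact: IH1.
  by near: z'; exact: IH2.
Unshelve. all: by end_near. Qed.

(** The product topology is the supremum of those induced by the coordinates, so local constancy of
    each symbol suffices. *)
Lemma bisequence_continuous (T : topologicalType) (f : T -> bisequence K) :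
  (forall k z, \forall z' \near z, f z' k = f z k) -> continuous f.
Proof.
move=> fk z; apply/cvg_sup => k U [? /= [[W oW <-]]] /= Wsfz /filterS; apply.
by apply: filterS (fk k z) => z' /= ->.
Qed.

End Coding.

(** * The conjugacy with the shift *)

Theorem theorem1 (R : realType) (K : completeNonArchFieldType R)
    (K_locally_compact : locally_compact [set: K])
    (K_nontrivial : exists x : K, x != 0 /\ absv x != 1)
    (pi : integer_ring K) (pi_uniformizer : uniformizer pi)
    (pi_normalized : absv (\val pi) = (residue_order K)%:R^-1)
    (a b : K) (a_gt0_lt1 : 0 < absv a < 1)
    (absv_b : absv b = (residue_order K)%:R) :
  exists T_A : attractor a b -> attractor a b,
    (forall z : attractor a b, \val (T_A z) = henon a b (\val z)) /\
    exists omega : bisequence K -> attractor a b,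
      homeomorphism omega /\
      (forall s : bisequence K, omega (shift s) = T_A (omega s)).
Proof.
have pi_gt0 := uniformizer_absv_gt0 K_nontrivial pi_uniformizer.
have pi01 : 0 < absv (\val pi) < 1 by rewrite pi_gt0 uniformizer_absv_lt1.
have lt1_le_pi := fun x => @uniformizer_absv_le _ K pi x pi_uniformizer.
(* For an infinite residue field [residue_order] is [0], forcing [pi = 0]. *)
have residue_finite : finite_set [set: residue_field K].
  apply: contraPP (lt0r_neq0 pi_gt0) => infF; rewrite pi_normalized.
  rewrite /residue_order /fset_set; case: pselect => // _.
  by rewrite cardfs0 invr0 eqxx.
have b_pi : absv b = (absv (\val pi))^-1 by rewrite absv_b pi_normalized invrK.
have a_neq0 : a != 0 by apply: contraTneq a_gt0_lt1 => ->; rewrite absv0 ltxx.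
have a_le1 : absv a <= 1 by case/andP: a_gt0_lt1 => _ /ltW.
have henon_integer (u : K) : u \in @integers _ K ->
    b * (u ^+ residue_order K - u) \in @integers _ K.
  move=> uO; rewrite inE absvM b_pi mulrC ler_pdivrMr// mul1r.
  exact/lt1_le_pi/absv_expf_order_sub.
(* [X s] is the orbit with residues [s]; [Y z], chosen below, is the orbit through the point [z]. *)
have /choice[X XP] (s : bisequence K) := exists_orbit residue_finite pi01
  lt1_le_pi a_le1 b_pi s.
have Xorb s : henon_orbit a b (X s) by case: (XP s).
have Xres s k : residue (X s k) = s k by case: (XP s).
have /choice[Y YP] (z : attractor a b) :
    exists x, henon_orbit a b x /\ \val z = (x 0, x (- 1)).
  have [x xorb zE] := attractor_orbit a_neq0 henon_integer a_le1 (set_valP z).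
  by exists x.
have Yorb (z : attractor a b) : henon_orbit a b (Y z) by case: (YP z).
have Yval (z : attractor a b) : \val z = (Y z 0, Y z (- 1)) by case: (YP z).
have shift_orbit x : henon_orbit a b x -> henon_orbit a b (fun k => x (k + 1)).
  move=> xorb k; have := xorb (k + 1); rewrite addrK => -[xO xE].
  by rewrite subrK.
(* The image of [z] is the initial pair of the shifted orbit; this is where the map turns into the
   shift. *)
have henonY (z : attractor a b) : henon a b (\val z) = (Y z 1, Y z 0).
  by rewrite Yval -[in RHS](add0r 1) (proj2 (Yorb z 0)) sub0r.
have TA (z : attractor a b) : attractor a b (henon a b (\val z)).
  by rewrite henonY; exact: (orbit_attractor (shift_orbit _ (Yorb z))).
pose T_A (z : attractor a b) : attractor a b := SigSub (mem_set (TA z)).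
pose omega (s : bisequence K) : attractor a b :=
  SigSub (mem_set (orbit_attractor (Xorb s))).
pose code (z : attractor a b) : bisequence K := fun k => residue (Y z k).
have Yomega s : Y (omega s) =1 X s.
  by apply: (orbit_eq_init a_neq0) => //; have [] := Yval (omega s).
exists T_A; split=> //; exists omega; split; last first.
  move=> s; apply: val_inj; rewrite -[RHS]/(henon a b (\val (omega s))).
  rewrite -[LHS]/(X (shift s) 0, X (shift s) (- 1)) henonY !Yomega.
  (* Both sides are orbits with residues [shift s], and residues determine the orbit. *)
  have E : X (shift s) =1 (fun k => X s (k + 1)).
    apply: (orbit_eq_residue residue_finite pi01 lt1_le_pi a_le1 b_pi) => //.
      exact: shift_orbit.
    by move=> k; rewrite !Xres.
  by rewrite !E.
split.
  have Xk k : continuous (X^~ k).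
    apply: (orbit_coding_continuous residue_finite pi01 lt1_le_pi a_le1 b_pi);
      by [].
  apply: continuous_comp_initial => s.
  exact: cvg_pair (Xk 0 s) (Xk (- 1) s).
exists code; split.
- by move=> s; apply/funext => k; rewrite /code Yomega Xres.
- move=> z; apply: val_inj; rewrite [RHS]Yval.
  rewrite -[LHS]/(X (code z) 0, X (code z) (- 1)).
  have E : X (code z) =1 Y z.
    apply: (orbit_eq_residue residue_finite pi01 lt1_le_pi a_le1 b_pi) => //.
    by move=> k; rewrite Xres.
  by rewrite !E.
apply: bisequence_continuous => k z.
have val_cont : continuous (fun z : attractor a b => \val z).
  exact: initial_continuous.
have Yk : continuous (Y^~ k).
  apply: (orbit_continuous pi01 a_neq0 a_le1 b_pi) => // z'.
    have -> : Y^~ 0 = fst \o (fun z : attractor a b => \val z).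
      by apply/funext => w; rewrite /= Yval.
    by apply: continuous_comp; [exact: val_cont | exact: cvg_fst].
  have -> : Y^~ (- 1) = snd \o (fun z : attractor a b => \val z).
    by apply/funext => w; rewrite /= Yval.
  by apply: continuous_comp; [exact: val_cont | exact: cvg_snd].
(* Radius [1] suffices: integral entries at distance less than [1] have the same residue. *)
have /cvg_ballP/(_ 1 ltr01) := Yk z; apply: filterS => z'.
rewrite /= ballEmdist/= mdist_absvE => Yz; apply/eqP.
have [zO _] := Yorb z k; have [z'O _] := Yorb z' k.
by rewrite /code residue_eq// absvBC.
Qed.
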